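(* Let $f_0 \in \mathcal{B}_0$. The following assertions are equivalent: (i) $f_0$ is a right zero divisor in $\mathcal{B}$; (ii) $f_0$ is a left zero divisor in $\mathcal{B}$; (iii) $f_0$ is a right zero divisor in $\mathcal{B}_0$; (iv) $f_0$ is a left zero divisor in $\mathcal{B}_0$; (v) $f_0$ belongs to the union of the ideals $\mathbf{J}xy = xy\mathbf{J}$ and $\mathbf{J}(z-xy) = (z-xy)\mathbf{J}$ of $\mathcal{B}_0$.
   Context: Let $\Bbbk$ be a (commutative) field of characteristic $p \neq 2$ ($p=0$ is allowed). The super Jordan plane $\mathcal{B}$ is the associative unital $\Bbbk$-algebra presented by generators $x, y$ with defining relations $x^2 = 0$ and $yz - zy - xz = 0$, where $z = xy + yx$. The relations are homogeneous for $\deg x = \deg y = 1$, so $\mathcal{B}$ is $\mathbb{Z}$-graded, and it is a superalgebra ($\mathbb{Z}/2\mathbb{Z}$-graded algebra) $\mathcal{B} = \mathcal{B}_0 \oplus \mathcal{B}_1$, where $\mathcal{B}_0$ (respectively $\mathcal{B}_1$) is the sum of the components of even (respectively odd) degree. $\mathbf{J}$ denotes the subalgebra of $\mathcal{B}$ generated by $z$ and $y^2$ (it is a copy of the Jordan plane, a domain, with relation $y^2 z - z y^2 = z^2$). One has $\mathcal{B}_0 = \mathbf{J} \oplus \mathbf{J}xy$. Convention on zero divisors in a ring $R$: $f$ is called a right zero divisor if there is $g \in R$, $g \neq 0$, with $fg = 0$, and a left zero divisor if there is $g \in R$, $g\neq 0$, with $gf = 0$. In particular $0$ counts as a zero divisor.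 *)

(* Defs.v *)
From HB Require Import structures.
From mathcomp Require Import all_boot all_algebra.
From mathcomp Require Import boolp classical_sets.
From mathcomp Require Import monalg.

Set Implicit Arguments.
Unset Strict Implicit.
Unset Printing Implicit Defensive.

Import GRing.Theory.
Local Open Scope ring_scope.
Local Open Scope quotient_scope.
Local Open Scope classical_set_scope.

Section RingNotions.
Variable R : nzRingType.
Implicit Types S I : set R.

Definition two_sided_ideal S I : Prop :=
  [/\ I `<=` S, I 0, (forall u v, I u -> I v -> I (u - v)),
      (forall s u, S s -> I u -> I (s * u))
    & (forall s u, S s -> I u -> I (u * s))].

Definition ideal_span (G : set R) : set R :=
  smallest (two_sided_ideal [set: R]) G.

(* The element [f] itself sits on the left for a right zero divisor, and 0 is
   a zero divisor of any [S] having a nonzero element. *)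
Definition right_zero_divisor S (f : R) : Prop :=
  exists g, [/\ S g, g != 0 & f * g = 0].

Definition left_zero_divisor S (f : R) : Prop :=
  exists g, [/\ S g, g != 0 & g * f = 0].

End RingNotions.

Section AlgebraNotions.
Variables (k : nzRingType) (A : lalgType k).

Definition subalgebra (S : set A) : Prop :=
  [/\ S 1, (forall (a : k) u v, S u -> S v -> S (a *: u + v))
    & (forall u v, S u -> S v -> S (u * v))].

Definition subalgebra_span (G : set A) : set A := smallest subalgebra G.

End AlgebraNotions.

Section SuperJordanPlane.
Variable k : fieldType.

(* The free algebra on two letters: [false] stands for x, [true] for y. *)
Local Notation free2 := {malg k[{fmonom bool}]}.

Definition free_x : free2 := << fmu false >>.
Definition free_y : free2 := << fmu true >>.
Definition free_z : free2 := free_x * free_y + free_y * free_x.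

Definition sjp_relations : set free2 :=
  [set free_x ^+ 2; free_y * free_z - free_z * free_y - free_x * free_z].

Definition sjp_ideal : set free2 := ideal_span sjp_relations.

Lemma sjp_ideal_two_sided : two_sided_ideal setT sjp_ideal.
Proof.
split=> //.
- by move=> I [[]].
- by move=> u v Iu Iv J JP; have [[_ _ JB _ _] _] := JP; apply: JB; [apply: Iu|apply: Iv].
- by move=> s u _ Iu J JP; have [[_ _ _ JM _] _] := JP; apply: JM => //; apply: Iu.
- by move=> s u _ Iu J JP; have [[_ _ _ _ JM] _] := JP; apply: JM => //; apply: Iu.
Qed.

Lemma sjp_ideal_proper : ~ sjp_ideal 1.
Proof.
pose e : {fmonom bool} := mone.
pose K : set free2 := [set f | f@_e = 0].
have K1 (i : bool) : (<< fmu i >> : free2)@_e = 0.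
  by rewrite mcoeffU /e fm1_eq1.
have KM (f g : free2) : (f * g)@_e = f@_e * g@_e.
  exact: (rmorphM (mcoeff e)).
have K11 : (1 : free2)@_e = 1 by rewrite mcoeff1 eqxx.
have KI : two_sided_ideal setT K /\ sjp_relations `<=` K.
  split; first split=> //.
  - exact: mcoeff0.
  - by move=> u v; rewrite /K /= mcoeffB => -> ->; rewrite subrr.
  - by move=> s u _; rewrite /K /= KM => ->; rewrite mulr0.
  - by move=> s u _; rewrite /K /= KM => ->; rewrite mul0r.
  move=> _ [->|->]; rewrite /K /=.
    by rewrite expr2 KM /free_x K1 mul0r.
  rewrite mcoeffB [X in _ - X = _]KM K1 mul0r subr0 mcoeffB.
  by rewrite [X in X - _ = _]KM [X in _ - X = _]KM K1 mul0r mulr0 subr0.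
by move=> /(_ K KI); rewrite /K /= K11 => /eqP; rewrite oner_eq0.
Qed.

Definition sjp_ideal_pred : {pred free2} := fun f => `[< sjp_ideal f >].

Lemma sjp_ideal_zmod_closed : zmod_closed sjp_ideal_pred.
Proof.
have [_ I0 IB _ _] := sjp_ideal_two_sided.
split; first exact/asboolP.
move=> u v /asboolP Iu /asboolP Iv; apply/asboolP; exact: IB.
Qed.

HB.instance Definition _ :=
  GRing.isZmodClosed.Build free2 sjp_ideal_pred sjp_ideal_zmod_closed.

(* The additive quotient by the ideal; multiplication and scaling are added
   below, since the library has quotient rings in the commutative case only. *)
Definition sjp : Type := Quotient.quot sjp_ideal_pred.
HB.instance Definition _ := GRing.Zmodule.on sjp.

Definition sjp_pi (f : free2) : sjp := \pi_(Quotient.quot sjp_ideal_pred) f.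
Definition sjp_repr (u : sjp) : free2 := repr (u : Quotient.quot sjp_ideal_pred).

Lemma sjp_reprK : cancel sjp_repr sjp_pi.
Proof. exact: reprK. Qed.

Lemma sjp_piP f g : sjp_pi f = sjp_pi g <-> sjp_ideal (f - g).
Proof.
split=> [/eqP|fg]; first by rewrite -Quotient.idealrBE => /asboolP.
by apply/eqP; rewrite -Quotient.idealrBE; apply/asboolP.
Qed.

Lemma sjp_pi_repr f : sjp_ideal (sjp_repr (sjp_pi f) - f).
Proof. by apply/sjp_piP; rewrite sjp_reprK. Qed.

Lemma sjp_pi_zmod_morphism : zmod_morphism sjp_pi.
Proof. by move=> f g; rewrite /sjp_pi !piE. Qed.

HB.instance Definition _ :=
  GRing.isZmodMorphism.Build free2 sjp sjp_pi sjp_pi_zmod_morphism.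

Definition sjp_one : sjp := sjp_pi 1.
Definition sjp_mul (u v : sjp) : sjp := sjp_pi (sjp_repr u * sjp_repr v).
Definition sjp_scale (c : k) (u : sjp) : sjp := sjp_pi (c *: sjp_repr u).

Lemma sjp_pi_mul f g : sjp_pi (f * g) = sjp_mul (sjp_pi f) (sjp_pi g).
Proof.
have [_ _ IB IMl IMr] := sjp_ideal_two_sided.
apply/esym/sjp_piP; set f' := sjp_repr _; set g' := sjp_repr _.
have -> : f' * g' - f * g = f' * (g' - g) - (f - f') * g.
  by rewrite mulrBr mulrBl opprB addrA subrK.
apply: (IB); first by apply: IMl => //; exact: sjp_pi_repr.
apply: (IMr) => //; rewrite -opprB -sub0r; apply: IB; last exact: sjp_pi_repr.
by case: sjp_ideal_two_sided.
Qed.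

Lemma sjp_pi_scale c f : sjp_pi (c *: f) = sjp_scale c (sjp_pi f).
Proof.
have [_ _ _ IMl _] := sjp_ideal_two_sided.
apply/esym/sjp_piP; rewrite -scalerBr -[_ - f]mul1r scalerAl.
by apply: IMl => //; exact: sjp_pi_repr.
Qed.

Lemma sjp_ind (P : sjp -> Prop) : (forall f, P (sjp_pi f)) -> forall u, P u.
Proof. by move=> Ppi u; rewrite -[u]sjp_reprK. Qed.

Lemma sjp_mulA : associative sjp_mul.
Proof.
by elim/sjp_ind=> u; elim/sjp_ind=> v; elim/sjp_ind=> w; rewrite -!sjp_pi_mul mulrA.
Qed.

Lemma sjp_mul1 : left_id sjp_one sjp_mul.
Proof. by elim/sjp_ind=> u; rewrite -sjp_pi_mul mul1r. Qed.

Lemma sjp_mulr1 : right_id sjp_one sjp_mul.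
Proof. by elim/sjp_ind=> u; rewrite -sjp_pi_mul mulr1. Qed.

Lemma sjp_mulDl : left_distributive sjp_mul +%R.
Proof.
elim/sjp_ind=> u; elim/sjp_ind=> v; elim/sjp_ind=> w.
by rewrite -raddfD -!sjp_pi_mul mulrDl raddfD.
Qed.

Lemma sjp_mulDr : right_distributive sjp_mul +%R.
Proof.
elim/sjp_ind=> u; elim/sjp_ind=> v; elim/sjp_ind=> w.
by rewrite -raddfD -!sjp_pi_mul mulrDr raddfD.
Qed.

Lemma sjp_one_neq0 : sjp_one != 0.
Proof.
apply/eqP; rewrite -(raddf0 sjp_pi) => /sjp_piP; rewrite subr0.
exact: sjp_ideal_proper.
Qed.

HB.instance Definition _ := GRing.Zmodule_isNzRing.Build sjp
  sjp_mulA sjp_mul1 sjp_mulr1 sjp_mulDl sjp_mulDr sjp_one_neq0.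

Lemma sjp_scaleA a b (u : sjp) :
  sjp_scale a (sjp_scale b u) = sjp_scale (a * b) u.
Proof. by elim/sjp_ind: u => u; rewrite -!sjp_pi_scale scalerA. Qed.

Lemma sjp_scale1 : left_id 1 sjp_scale.
Proof. by elim/sjp_ind=> u; rewrite -sjp_pi_scale scale1r. Qed.

Lemma sjp_scaleDr : right_distributive sjp_scale +%R.
Proof.
move=> a; elim/sjp_ind=> u; elim/sjp_ind=> v.
by rewrite -raddfD -!sjp_pi_scale scalerDr raddfD.
Qed.

Lemma sjp_scaleDl (u : sjp) : {morph sjp_scale^~ u : a b / a + b}.
Proof.
by move=> a b; elim/sjp_ind: u => u; rewrite -!sjp_pi_scale scalerDl raddfD.
Qed.

HB.instance Definition _ := GRing.Zmodule_isLmodule.Build k sjp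
  sjp_scaleA sjp_scale1 sjp_scaleDr sjp_scaleDl.

Lemma sjp_pi_monoid_morphism : monoid_morphism sjp_pi.
Proof. by split; [reflexivity | exact: sjp_pi_mul]. Qed.

HB.instance Definition _ :=
  GRing.isMonoidMorphism.Build free2 sjp sjp_pi sjp_pi_monoid_morphism.

HB.instance Definition _ :=
  GRing.isScalable.Build k free2 sjp *:%R sjp_pi sjp_pi_scale.

Lemma sjp_scaleAl (a : k) (u v : sjp) : a *: (u * v) = a *: u * v.
Proof.
elim/sjp_ind: u => u; elim/sjp_ind: v => v.
by rewrite -rmorphM -!linearZ -rmorphM /= scalerAl.
Qed.

HB.instance Definition _ := GRing.Lmodule_isLalgebra.Build k sjp sjp_scaleAl.

Lemma free2_scaleAr (a : k) (u v : free2) : a *: (u * v) = u * (a *: v).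
Proof.
have aU c (m : {fmonom bool}) : a *: << c *g m >> = << a * c *g m >> :> free2.
  by apply/malgP => m'; rewrite mcoeffZ !mcoeffU mulrnAr.
rewrite [u * (a *: v)]malgM_def (fgmulrwl (msuppZ_le a v)).
rewrite [u * v]malgM_def fgmulr scaler_sumr; apply: eq_bigr => k2 _.
rewrite scaler_sumr; apply: eq_bigr => k1 _.
by rewrite aU mcoeffZ mulrCA.
Qed.

Lemma sjp_scaleAr (a : k) (u v : sjp) : a *: (u * v) = u * (a *: v).
Proof.
elim/sjp_ind: u => u; elim/sjp_ind: v => v.
by rewrite -rmorphM -!linearZ -rmorphM /= free2_scaleAr.
Qed.

HB.instance Definition _ := GRing.Lalgebra_isAlgebra.Build k sjp sjp_scaleAr.

Definition sjp_x : sjp := sjp_pi free_x.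
Definition sjp_y : sjp := sjp_pi free_y.
Definition sjp_z : sjp := sjp_x * sjp_y + sjp_y * sjp_x.

Lemma sjp_relations0 f : sjp_relations f -> sjp_pi f = 0.
Proof.
move=> rf; rewrite -(raddf0 sjp_pi); apply/sjp_piP; rewrite subr0.
by move=> J [_]; apply.
Qed.

Lemma sjp_pi_z : sjp_pi free_z = sjp_z.
Proof.
rewrite /free_z raddfD.
rewrite -[RHS]/(sjp_mul sjp_x sjp_y + sjp_mul sjp_y sjp_x).
by rewrite -(sjp_pi_mul free_x) -(sjp_pi_mul free_y); exact: erefl.
Qed.

Lemma sjp_relation_x : sjp_x ^+ 2 = 0.
Proof. by rewrite -rmorphXn; apply: sjp_relations0; left. Qed.

Lemma sjp_relation_yz : sjp_y * sjp_z - sjp_z * sjp_y - sjp_x * sjp_z = 0.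
Proof.
have piM (f g : free2) : sjp_pi f * sjp_pi g = sjp_pi (f * g) by rewrite rmorphM.
by rewrite -sjp_pi_z !piM -!raddfB; apply: sjp_relations0; right.
Qed.

Definition free2_homog (d : nat) : set free2 :=
  [set f | forall m, f@_m != 0 -> fdeg m = d].

Definition sjp_homog (d : nat) : set sjp := sjp_pi @` free2_homog d.

Definition sjp_even : set sjp :=
  [set f | exists n (c : 'I_n -> sjp),
     (forall i, sjp_homog (val i).*2 (c i)) /\ f = \sum_(i < n) c i].

Definition sjp_J : set sjp := subalgebra_span [set sjp_z; sjp_y ^+ 2].

Definition sjp_Jr (u : sjp) : set sjp := [set a * u | a in sjp_J].
Definition sjp_lJ (u : sjp) : set sjp := [set u * a | a in sjp_J].

End SuperJordanPlane.

(* Unification would otherwise unfold these down to the free algebra. *)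
#[global] Opaque sjp_pi sjp_repr sjp_one sjp_mul sjp_scale.

Arguments sjp_x {k}.
Arguments sjp_y {k}.
Arguments sjp_z {k}.
Arguments sjp_even {k}.
Arguments sjp_J {k}.

(* Main.v *)
From HB Require Import structures.
Require Import Defs.
From mathcomp Require Import all_boot all_algebra.
From mathcomp Require Import boolp classical_sets.
From mathcomp Require Import monalg finmap.

(** Write t = y^2, u = xy and v = z - xy = yx.  The relations give u v = v u = 0
    and u + v = z, so an even element a + b u, with a and b in J, is killed by v
    on both sides when a = 0, and by u on both sides when it is - b v, that is,
    when a + b z = 0.  What remains of the equivalence is that a + b u is regular
    in the whole algebra as soon as a and a + b z are both nonzero.

    This is read off a faithful representation by 2 x 2 matrices over J, given by
    x = [0, z; 0, 0] and y = [0, t; 1, 0] with rows separated by semicolons,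
    in which J acts by scalar matrices and a + b u by the diagonal matrix with
    entries a + b z and a.  Up to the automorphism of J fixing z and sending t to
    t - z, it is the action of the algebra on its left ideal generated by x,
    which is free of rank two as a right J-module, with basis x, yx; in that basis
    the upper right entry of y is t + z.  On the normal form a + b u + c x + d y it
    takes the value with rows (a + b z, c z + d t) and (d, a); as J is a domain, it
    is faithful ([rho_inj]), and a diagonal matrix with nonzero entries is regular
    ([superjordan_even_regular]).

    Two ingredients are needed.  The first is a model of J as a domain: it is
    built as the ring of differential operators k[z][s; z^2 d/dz], whose
    underlying group is that of polynomials in s over k[z]; leading coefficients
    multiply there ([ore_mul_eq0]).  The second is that normal forms span
    ([sjp_spanning]) and that the even ones fill the even part of the grading
    ([sjp_evenE]).

    That J u and J v are two-sided ideals of the even part and agree with u J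
    and v J follows from one observation: x, z, u and v all satisfy w z = z w and
    w t = (t - z) w, so moving w across J only twists J by the automorphism
    fixing z and sending t to t - z ([normal_leftright], [normal_ideal]).

    The argument about x, y and z is carried out in any algebra with elements
    obeying the relations, and specialized to the quotient of the free algebra
    at the end. *)

Set Implicit Arguments.
Unset Strict Implicit.
Unset Printing Implicit Defensive.

Import GRing.Theory.
Local Open Scope ring_scope.
Local Open Scope classical_set_scope.

(** * Differential operator rings over a domain *)
Section DifferentialOperators.
Variables (R : idomainType) (delta : {additive R -> R}).
Hypothesis deltaM : forall a b, delta (a * b) = delta a * b + a * delta b.
Implicit Types (f g h : {poly R}) (c : R).

(** Left multiplication by the variable s in R[s; delta], where
    s c = c s + delta c and coefficients are written on the left. *)
Definition ore_shift f : {poly R} := f * 'X + map_poly delta f.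

(** The variable acts on the left by [ore_shift], so the coefficient f_i s^i acts
    as f_i times the i-th iterate of it. *)
Definition ore_mul f g : {poly R} := \sum_(i < size f) f`_i *: iter i ore_shift g.

Lemma ore_shift_is_additive : zmod_morphism ore_shift.
Proof.
by move=> f g; rewrite /ore_shift mulrBl raddfB /= opprD addrACA.
Qed.

HB.instance Definition _ :=
  GRing.isZmodMorphism.Build {poly R} {poly R} ore_shift ore_shift_is_additive.

Lemma iter_ore_shiftD i f g :
  iter i ore_shift (f + g) = iter i ore_shift f + iter i ore_shift g.
Proof. by elim: i => //= i ->; rewrite raddfD. Qed.

Lemma ore_shiftZ c f : ore_shift (c *: f) = c *: ore_shift f + delta c *: f.
Proof.
apply/polyP=> i; rewrite !(coefD, coefZ) !coefMX !coef_map /= !coefZ deltaM.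
by case: eqP => _; rewrite ?add0r ?mulrDr -?addrA [delta c * _ + _]addrC.
Qed.

Lemma ore_shiftMX f : ore_shift (f * 'X) = ore_shift f * 'X.
Proof.
rewrite /ore_shift mulrDl; congr (_ + _).
apply/polyP=> i; rewrite coef_map /= !coefMX coef_map /=.
by case: eqP => _ //; rewrite raddf0.
Qed.

Lemma ore_shiftC c : ore_shift c%:P = c *: 'X + (delta c)%:P.
Proof. by rewrite /ore_shift map_polyC mul_polyC. Qed.

Lemma ore_mulE n f g : (size f <= n)%N ->
  ore_mul f g = \sum_(i < n) f`_i *: iter i ore_shift g.
Proof.
move=> le_fn; rewrite /ore_mul (big_ord_widen n (fun i => f`_i *: iter i ore_shift g)) //.
rewrite [RHS](bigID (fun i : 'I_n => (i < size f)%N)) /= [X in _ + X]big1 ?addr0 //.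
by move=> i; rewrite -leqNgt => le_fi; rewrite nth_default // scale0r.
Qed.

Lemma ore_mulDl f g h : ore_mul (f + g) h = ore_mul f h + ore_mul g h.
Proof.
have le_n := size_polyD f g; move: (maxn _ _) (leq_maxl (size f) (size g))
  (leq_maxr (size f) (size g)) le_n => n le_f le_g le_fg.
rewrite !(@ore_mulE n) //.
by rewrite -big_split /=; apply: eq_bigr => i _; rewrite coefD scalerDl.
Qed.

Lemma ore_mulDr f g h : ore_mul f (g + h) = ore_mul f g + ore_mul f h.
Proof.
by rewrite -big_split /=; apply: eq_bigr => i _; rewrite iter_ore_shiftD scalerDr.
Qed.

Lemma ore_mul0f f : ore_mul 0 f = 0.
Proof. by rewrite /ore_mul size_poly0 big_ord0. Qed.

Lemma ore_mulZl c f g : ore_mul (c *: f) g = c *: ore_mul f g.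
Proof.
rewrite (@ore_mulE (size f)) ?size_scale_leq // scaler_sumr.
by apply: eq_bigr => i _; rewrite coefZ scalerA.
Qed.

Lemma ore_mulC c f : ore_mul c%:P f = c *: f.
Proof. by rewrite (@ore_mulE 1) ?size_polyC_leq1 // big_ord1 /= coefC. Qed.

Lemma ore_mulMX f g : ore_mul (f * 'X) g = ore_mul f (ore_shift g).
Proof.
rewrite (@ore_mulE (size f).+1); last first.
  by rewrite (leq_trans (size_polyMleq _ _)) // size_polyX addn2.
rewrite big_ord_recl coefMX scale0r add0r; apply: eq_bigr => i _.
by rewrite coefMX /= -iterSr.
Qed.

(** The case of associativity in which the first factor is the variable; the
    general case reduces to it by writing the first factor as f s + c. *)
Lemma ore_mul_shift f g : ore_mul (ore_shift f) g = ore_shift (ore_mul f g).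
Proof.
elim/poly_ind: f g => [|f c IHf] g; first by rewrite raddf0 !ore_mul0f raddf0.
rewrite raddfD /= ore_shiftMX ore_shiftC addrA -mul_polyC -mulrDl.
rewrite !ore_mulDl !ore_mulMX ore_mulDl IHf !ore_mulC.
by rewrite [RHS]raddfD /= ore_shiftZ addrA.
Qed.

Lemma ore_mulA : associative ore_mul.
Proof.
move=> f g h; elim/poly_ind: f g => [|f c IHf] g; first by rewrite !ore_mul0f.
by rewrite !ore_mulDl !ore_mulMX !ore_mulC ore_mulZl -IHf ore_mul_shift.
Qed.

Lemma ore_mul1f : left_id 1 ore_mul.
Proof. by move=> f; rewrite -polyC1 ore_mulC scale1r. Qed.

Lemma ore_mulrX f g : ore_mul f (g * 'X) = ore_mul f g * 'X.
Proof.
elim/poly_ind: f g => [|f c IHf] g; first by rewrite !ore_mul0f mul0r.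
by rewrite !ore_mulDl !ore_mulMX !ore_mulC ore_shiftMX IHf mulrDl scalerAl.
Qed.

Lemma ore_mulf1 : right_id 1 ore_mul.
Proof.
elim/poly_ind=> [|f c IHf]; first by rewrite ore_mul0f.
rewrite ore_mulDl ore_mulMX ore_mulC alg_polyC /ore_shift.
have -> : map_poly delta 1 = (delta 1)%:P by rewrite -polyC1 map_polyC.
have /eqP := deltaM 1 1; rewrite !mul1r mulr1 -subr_eq subrr eq_sym => /eqP ->.
by rewrite polyC0 addr0 -{1}['X]mul1r ore_mulrX IHf.
Qed.

(** The term added by delta does not raise the degree, so s^n f has the leading
    coefficient of f. *)
Lemma iter_ore_shift_lead n f m : (size f <= m.+1)%N ->
  (size (iter n ore_shift f) <= (n + m).+1)%N /\
  (iter n ore_shift f)`_(n + m) = f`_m.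
Proof.
move=> le_fm; elim: n => //= n [le_size lead]; set g := iter n _ f in le_size lead *.
have le_dg : (size (map_poly delta g) <= (n + m).+1)%N.
  by rewrite (leq_trans (size_poly _ _)).
split.
  rewrite (leq_trans (size_polyD _ _)) // geq_max (leq_trans le_dg) ?leqnSn // andbT.
  by rewrite (leq_trans (size_polyMleq _ _)) // size_polyX addn2 addSn ltnS.
by rewrite addSn coefD coefMX /= lead [X in _ + X]nth_default ?addr0.
Qed.

(** The leading coefficient of a product is the product of the leading
    coefficients, since only the top term of f reaches the top degree. *)
Lemma ore_mul_eq0 f g : ore_mul f g = 0 -> f = 0 \/ g = 0.
Proof.
have [->|f0] := eqVneq f 0; first by left.
have [->|g0] := eqVneq g 0; first by right.
move=> fg0; exfalso.
have [n sf] : exists n, size f = n.+1 by exists (size f).-1; rewrite prednK ?size_poly_gt0.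
have [m sg] : exists m, size g = m.+1 by exists (size g).-1; rewrite prednK ?size_poly_gt0.
have : (ore_mul f g)`_(n + m) = f`_n * g`_m.
  rewrite /ore_mul sf big_ord_recr /= coefD coefZ coef_sum big1 ?add0r.
    by have [_ ->] := @iter_ore_shift_lead n g m (eq_leq sg).
  move=> i _; have [le_size _] := @iter_ore_shift_lead i g m (eq_leq sg).
  by rewrite coefZ [X in _ * X]nth_default ?mulr0 // (leq_trans le_size) // -addSn leq_add2r.
rewrite fg0 coef0 => /esym/eqP; rewrite mulf_eq0.
have -> : f`_n = lead_coef f by rewrite lead_coefE sf.
have -> : g`_m = lead_coef g by rewrite lead_coefE sg.
by rewrite !lead_coef_eq0 (negPf f0) (negPf g0).
Qed.

End DifferentialOperators.

(** * The Jordan plane *)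
Section JordanPlane.
Variable k : fieldType.

Definition jordan_derivation (c : {poly k}) : {poly k} := 'X^2 * c^`().

Lemma jordan_derivation_is_additive : zmod_morphism jordan_derivation.
Proof. by move=> a b; rewrite /jordan_derivation derivB mulrBr. Qed.

HB.instance Definition _ := GRing.isZmodMorphism.Build {poly k} {poly k}
  jordan_derivation jordan_derivation_is_additive.

Lemma jordan_derivationM a b :
  jordan_derivation (a * b) = jordan_derivation a * b + a * jordan_derivation b.
Proof. by rewrite /jordan_derivation derivM mulrDr mulrA mulrCA. Qed.

(** The elements are polynomials in s over k[z], but the product is the twisted
    one; the alias keeps it apart from the commutative product. *)
Definition jordan : Type := {poly {poly k}}.
HB.instance Definition _ := GRing.Zmodule.on jordan.

Definition jordan_mul : jordan -> jordan -> jordan := ore_mul jordan_derivation.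

Lemma jordan_mulA : associative jordan_mul.
Proof. exact/ore_mulA/jordan_derivationM. Qed.
Lemma jordan_mul1f : left_id (1 : {poly {poly k}}) jordan_mul.
Proof. exact: ore_mul1f. Qed.
Lemma jordan_mulf1 : right_id (1 : {poly {poly k}}) jordan_mul.
Proof. exact/ore_mulf1/jordan_derivationM. Qed.
Lemma jordan_mulDl : left_distributive jordan_mul +%R.
Proof. exact: ore_mulDl. Qed.
Lemma jordan_mulDr : right_distributive jordan_mul +%R.
Proof. exact: ore_mulDr. Qed.
Lemma jordan_one_neq0 : (1 : {poly {poly k}}) != (0 : jordan).
Proof. exact: oner_neq0. Qed.

HB.instance Definition _ := GRing.Zmodule_isNzRing.Build jordan
  jordan_mulA jordan_mul1f jordan_mulf1 jordan_mulDl jordan_mulDr jordan_one_neq0.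

Definition jordan_const (c : {poly k}) : jordan := c%:P.
Definition jordan_z : jordan := jordan_const 'X.
Definition jordan_s : jordan := ('X : {poly {poly k}}).

Lemma jordan_mul_eq0 (f g : jordan) : f * g = 0 -> f = 0 \/ g = 0.
Proof. exact: ore_mul_eq0. Qed.

Lemma jordan_const_is_zmod_morphism : zmod_morphism jordan_const.
Proof. exact: polyCB. Qed.
HB.instance Definition _ := GRing.isZmodMorphism.Build {poly k} jordan
  jordan_const jordan_const_is_zmod_morphism.

Lemma jordan_constM_scale c (f : jordan) : jordan_const c * f = c *: (f : {poly {poly k}}).
Proof. exact: ore_mulC. Qed.

Lemma jordan_const_is_monoid_morphism : monoid_morphism jordan_const.
Proof.
split=> // a b; rewrite jordan_constM_scale /jordan_const /=.
by rewrite -mul_polyC polyCM.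
Qed.
HB.instance Definition _ := GRing.isMonoidMorphism.Build {poly k} jordan
  jordan_const jordan_const_is_monoid_morphism.

Lemma jordan_mulrs (f : jordan) : f * jordan_s = (f : {poly {poly k}}) * 'X.
Proof.
rewrite -[RHS](congr1 (fun g => g * 'X) (jordan_mulf1 f)).
by rewrite -[RHS]ore_mulrX mul1r.
Qed.

Lemma jordan_mulsf (f : jordan) : jordan_s * f = ore_shift jordan_derivation f.
Proof.
transitivity (ore_mul jordan_derivation (1 * 'X) f); first by rewrite mul1r.
by rewrite ore_mulMX ore_mul1f.
Qed.

Lemma jordan_mul_s_const c :
  jordan_s * jordan_const c
    = jordan_const c * jordan_s + jordan_const (jordan_derivation c).
Proof. by rewrite jordan_mulsf ore_shiftC jordan_constM_scale. Qed.

Lemma jordan_mul_sz : jordan_s * jordan_z = jordan_z * jordan_s + jordan_z * jordan_z.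
Proof.
by rewrite jordan_mul_s_const -rmorphM /jordan_derivation derivX mulr1 expr2.
Qed.

(** Multiplication by s on the right is untwisted, so the Horner decomposition
    f s + c of a polynomial is also one for the twisted product. *)
Lemma jordan_ind (P : jordan -> Prop) :
  P 0 -> (forall f c, P f -> P (f * jordan_s + jordan_const c)) -> forall f, P f.
Proof.
move=> P0 PS; elim/poly_ind=> [|f c Pf]; first exact: P0.
by have := PS f c Pf; rewrite jordan_mulrs.
Qed.

Lemma jordan_scalar_central (a : k) (f : jordan) : GRing.comm (jordan_const a%:P) f.
Proof.
elim/jordan_ind: f => [|f c IHf]; first exact: commr0.
apply: commrD.
  apply: commrM => //; rewrite /GRing.comm jordan_mul_s_const.
  by rewrite /jordan_derivation derivC mulr0 raddf0 addr0.
by rewrite /GRing.comm -!rmorphM mulrC.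
Qed.

Lemma jordan_z_neq0 : jordan_z != 0.
Proof. by rewrite /jordan_z /jordan_const polyC_eq0 polyX_eq0. Qed.

End JordanPlane.

(** * Evaluating the Jordan plane in an algebra *)
Section JordanEvaluation.
Variables (k : fieldType) (A : algType k) (z t : A).
Hypothesis tz : t * z = z * t + z * z.

(** Coefficients stay to the left of the powers of t, as in the twisted ring. *)
Definition jordan_eval (f : jordan k) : A :=
  (map_poly (horner_alg z) (f : {poly {poly k}})).[t].

Lemma jordan_eval_is_zmod_morphism : zmod_morphism jordan_eval.
Proof. by move=> f g; rewrite /jordan_eval rmorphB hornerD hornerN. Qed.
HB.instance Definition _ := GRing.isZmodMorphism.Build (jordan k) A
  jordan_eval jordan_eval_is_zmod_morphism.

Lemma jordan_eval_const c : jordan_eval (jordan_const c) = horner_alg z c.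
Proof. by rewrite /jordan_eval map_polyC hornerC. Qed.

Lemma jordan_eval_z : jordan_eval (jordan_z k) = z.
Proof. by rewrite jordan_eval_const /= horner_algX. Qed.

Lemma jordan_evalMs f : jordan_eval (f * jordan_s k) = jordan_eval f * t.
Proof. by rewrite jordan_mulrs /jordan_eval rmorphM /= map_polyX hornerMX. Qed.

Lemma jordan_eval_constM c f :
  jordan_eval (jordan_const c * f) = horner_alg z c * jordan_eval f.
Proof.
elim/jordan_ind: f => [|f d IHf]; first by rewrite mulr0 raddf0 mulr0.
rewrite mulrDr !raddfD /= mulrA jordan_evalMs IHf mulrDr jordan_evalMs mulrA.
by rewrite -rmorphM !jordan_eval_const rmorphM.
Qed.

(** Commuting t past a polynomial in z produces the derivation z^2 d/dz, because it
    does so for z itself. *)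
Lemma jordan_evalsM f : jordan_eval (jordan_s k * f) = t * jordan_eval f.
Proof.
have tc c : t * horner_alg z c
    = horner_alg z c * t + horner_alg z (jordan_derivation c).
  elim/poly_ind: c => [|c a IHc]; first by rewrite !raddf0 mulr0 mul0r addr0.
  have -> : jordan_derivation (c * 'X + a%:P)
      = jordan_derivation c * 'X + c * 'X * 'X.
    rewrite raddfD /= jordan_derivationM {2 3}/jordan_derivation derivX derivC.
    by rewrite mulr0 addr0 mulr1 expr2 mulrA.
  move: (jordan_derivation c) IHc => d IHc.
  rewrite !(rmorphD, rmorphM) /= horner_algX horner_algC.
  rewrite mulrDr mulrA IHc mulrDl -[_ * t * z]mulrA tz mulrDr mulrA.
  rewrite mulrDl -scalerAr mulr1 -scalerAl mul1r -!addrA; congr (_ + _).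
  by rewrite mulrA addrA addrC [_ + horner_alg z d * z]addrC.
elim/jordan_ind: f => [|f c IHf]; first by rewrite mulr0 raddf0 mulr0.
rewrite mulrDr !raddfD /= mulrA !jordan_evalMs IHf mulrDr mulrA.
by rewrite jordan_mul_s_const raddfD /= jordan_evalMs !jordan_eval_const tc.
Qed.

Lemma jordan_eval_is_monoid_morphism : monoid_morphism jordan_eval.
Proof.
split; first by rewrite -[1](rmorph1 (@jordan_const k)) jordan_eval_const rmorph1.
elim/jordan_ind=> [|f c IHf] g; first by rewrite mul0r raddf0 mul0r.
rewrite mulrDl -mulrA !raddfD /= IHf jordan_evalsM jordan_eval_constM jordan_evalMs.
by rewrite mulrDl jordan_eval_const mulrA.
Qed.

Lemma jordan_eval_s : jordan_eval (jordan_s k) = t.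
Proof. by rewrite /jordan_eval map_polyX hornerX. Qed.

Lemma jordan_eval_scale (a : k) f :
  jordan_eval (jordan_const a%:P * f) = a *: jordan_eval f.
Proof. by rewrite jordan_eval_constM horner_algC -scalerAl mul1r. Qed.

Lemma subalgebra_span_jordan : subalgebra_span [set z; t] = range jordan_eval.
Proof.
apply/seteqP; split=> [w Jw|_ [f _ <-] S [[S1 SD SM] Szt]].
  apply: Jw; split; last first.
    by move=> _ [->|->]; [exists (jordan_z k); rewrite ?jordan_eval_z
                        | exists (jordan_s k); rewrite ?jordan_eval_s].
  split; first by exists 1; rewrite ?jordan_eval_is_monoid_morphism.1.
    move=> a _ _ [f _ <-] [g _ <-]; exists (jordan_const a%:P * f + g) => //.
    by rewrite raddfD /= jordan_eval_scale.
  by move=> _ _ [f _ <-] [g _ <-]; exists (f * g); rewrite ?jordan_eval_is_monoid_morphism.2.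
have S0 : S 0 by have := SD (-1) 1 1 S1 S1; rewrite scaleN1r addNr.
have SDD u v : S u -> S v -> S (u + v) by rewrite -{2}[u]scale1r; exact: SD.
have Sc c : S (horner_alg z c).
  elim/poly_ind: c => [|c a Sc]; first by rewrite rmorph0.
  rewrite rmorphD rmorphM /= horner_algX horner_algC; apply: SDD.
    by apply: SM => //; apply: Szt; left.
  by rewrite -[a%:A]addr0; apply: SD.
elim/jordan_ind: f => [|f c Sf]; first by rewrite raddf0.
rewrite raddfD /= jordan_evalMs jordan_eval_const; apply: SDD => //.
by apply: SM => //; apply: Szt; right.
Qed.

End JordanEvaluation.

(** * Consequences of the defining relations *)
Section Relations.
Variables (k : fieldType) (A : algType k) (x y z : A).
Hypothesis zE : z = x * y + y * x.
Hypothesis xx : x * x = 0.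
Hypothesis yz : y * z = z * y + x * z.
Local Notation t := (y ^+ 2).
Local Notation xy := (x * y).

(** As z and t generate J, this amounts to w a = sigma(a) w for all a in J, where
    sigma is the automorphism of J fixing z and sending t to t - z. *)
Definition jordan_normal (w : A) : Prop := w * z = z * w /\ w * t = (t - z) * w.

Lemma superjordan_yx : y * x = z - xy.
Proof. by rewrite zE addrC addKr. Qed.

Lemma superjordan_xz : x * z = z * x.
Proof.
by rewrite zE mulrDr mulrDl mulrA xx mul0r add0r -[y * x * x]mulrA xx mulr0 addr0 mulrA.
Qed.

Lemma superjordan_tx : t * x = x * t + z * x.
Proof.
rewrite expr2 -mulrA superjordan_yx mulrBr yz [y * xy]mulrA superjordan_yx.
rewrite [(z - xy) * y]mulrBl.
by rewrite opprB -!mulrA [LHS]addrC addrA subrK superjordan_xz.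
Qed.

Lemma superjordan_tz : t * z = z * t + z * z.
Proof.
have xyz : xy * z = x * z * y.
  by rewrite -mulrA yz mulrDr [x * (x * z)]mulrA xx mul0r addr0 mulrA.
rewrite expr2 -[y * y * z]mulrA yz mulrDr [y * (z * y)]mulrA yz.
rewrite [y * (x * z)]mulrA superjordan_yx [(z - xy) * z]mulrBl xyz mulrDl -[z * y * y]mulrA.
by rewrite -addrA [X in _ + X]addrCA subrr addr0.
Qed.

Lemma jordan_normal_x : jordan_normal x.
Proof. by split; [exact: superjordan_xz | rewrite mulrBl superjordan_tx addrK]. Qed.

Lemma jordan_normal_z : jordan_normal z.
Proof. by split=> //; rewrite mulrBl superjordan_tz addrK. Qed.

Lemma jordan_normal_xy : jordan_normal xy.
Proof.
have [_ xt] := jordan_normal_x; split.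
  by rewrite -mulrA yz mulrDr [x * (x * z)]mulrA xx mul0r addr0 !mulrA superjordan_xz.
have yt : y * t = t * y by rewrite -exprS -exprSr.
by rewrite -mulrA yt mulrA xt mulrA.
Qed.

Lemma jordan_normalB v w : jordan_normal v -> jordan_normal w -> jordan_normal (v - w).
Proof.
by case=> vz vt [wz wt]; split; rewrite mulrBl mulrBr ?vz ?wz ?vt ?wt.
Qed.

Lemma superjordan_xyx : xy * x = z * x.
Proof. by rewrite -mulrA superjordan_yx mulrBr mulrA xx mul0r subr0 superjordan_xz. Qed.

Lemma superjordan_xyxy : xy * xy = z * xy.
Proof. by rewrite mulrA superjordan_xyx mulrA. Qed.

Lemma superjordan_xy_yx : xy * (z - xy) = 0.
Proof. by rewrite mulrBr superjordan_xyxy (jordan_normal_xy).1 subrr. Qed.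

Lemma superjordan_yx_xy : (z - xy) * xy = 0.
Proof. by rewrite mulrBl superjordan_xyxy subrr. Qed.

End Relations.

(** * Linear maps and morphisms on the free algebra *)
Section FreeAlgebra.
Variable k : fieldType.

Lemma malg_lin_ind (K : choiceType) (A : lmodType k) (phi : {linear {malg k[K]} -> A})
    (S : set A) (f : {malg k[K]}) :
  S 0 -> (forall a u v, S u -> S v -> S (a *: u + v)) ->
  (forall m, f@_m != 0 -> S (phi << m >>)) -> S (phi f).
Proof.
move=> S0 SL Sm; rewrite [f]monalgE raddf_sum big_seq; apply: big_ind => //.
  by move=> u v Su Sv; rewrite -[u]scale1r; exact: SL.
move=> m; rewrite -mcoeff_neq0 => fm.
have -> : << f@_m *g m >> = f@_m *: << m >> :> {malg k[K]}.
  by apply/malgP => n; rewrite mcoeffZ !mcoeffU mulrnAr mulr1.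
by rewrite /= linearZ /= -[_ *: _]addr0; apply: SL => //; exact: Sm.
Qed.

Lemma malg_word (A : nzRingType) (phi : {rmorphism {malg k[{fmonom bool}]} -> A})
    (m : {fmonom bool}) :
  phi << m >> = \prod_(i <- m) if i then phi << fmu true >> else phi << fmu false >>.
Proof.
case: m => s; elim: s => [|i s IHs].
  by rewrite big_nil -[FMonom _]fmoneE -[RHS](rmorph1 phi).
rewrite big_cons /= -IHs.
have -> : FMonom (i :: s) = mmul (fmu i) (FMonom s) by apply/val_inj; rewrite /= fmM fmU.
have -> : << mmul (fmu i) (FMonom s) >>
    = << fmu i >> * << FMonom s >> :> {malg k[{fmonom bool}]}.
  by rewrite malgM_def fgmulUU mulr1.
by rewrite rmorphM; case: i.
Qed.

End FreeAlgebra.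

Lemma kernel_two_sided (F S : nzRingType) (phi : {rmorphism F -> S}) :
  two_sided_ideal [set: F] [set f | phi f = 0].
Proof.
split=> [//||u v u0 v0|u v _ v0|u v _ v0] /=; first exact: rmorph0.
- by rewrite rmorphB u0 v0 subrr.
- by rewrite rmorphM v0 mulr0.
- by rewrite rmorphM v0 mul0r.
Qed.

(** * The representation by two by two matrices *)
Section TwoByTwo.
Variable R : nzRingType.
Implicit Types a b c d : R.

Definition mx2 a b c d : 'M[R]_2 :=
  \matrix_(i, j) nth 0 (nth [::] [:: [:: a; b]; [:: c; d]] i) j.

Lemma mx2P (M : 'M[R]_2) : M = mx2 (M 0 0) (M 0 1) (M 1 0) (M 1 1).
Proof.
by apply/matrixP; do 2![case=> [[|[|//]]] ?]; rewrite !mxE; congr (M _ _); exact: val_inj.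
Qed.

Lemma mx2_inj a b c d a' b' c' d' : mx2 a b c d = mx2 a' b' c' d' ->
  [/\ a = a', b = b', c = c' & d = d'].
Proof.
move=> /matrixP E; split.
- by have := E 0 0; rewrite !mxE.
- by have := E 0 1; rewrite !mxE.
- by have := E 1 0; rewrite !mxE.
- by have := E 1 1; rewrite !mxE.
Qed.

Lemma mx2_0 : 0 = mx2 0 0 0 0.
Proof. by rewrite [LHS]mx2P !mxE. Qed.

Lemma mx2_scalar a : a%:M = mx2 a 0 0 a.
Proof. by rewrite [LHS]mx2P !mxE. Qed.

Lemma mx2D a b c d a' b' c' d' :
  mx2 a b c d + mx2 a' b' c' d' = mx2 (a + a') (b + b') (c + c') (d + d').
Proof. by rewrite [LHS]mx2P !mxE. Qed.

Lemma mx2M a b c d a' b' c' d' :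
  mx2 a b c d * mx2 a' b' c' d'
    = mx2 (a * a' + b * c') (a * b' + b * d') (c * a' + d * c') (c * b' + d * d').
Proof. by rewrite [LHS]mx2P !mxE !big_ord_recl !big_ord0 /= !mxE /= !addr0. Qed.

End TwoByTwo.

Section Representation.
Variable k : fieldType.
Local Notation J := (jordan k).
Local Notation z := (jordan_z k).
Local Notation s := (jordan_s k).
Local Notation free2 := {malg k[{fmonom bool}]}.

Lemma superjordan_mx_z (F : nzRingType) (phi : {rmorphism F -> 'M[J]_2}) (x y : F) :
  phi x = mx2 0 z 0 0 -> phi y = mx2 0 s 1 0 -> phi (x * y + y * x) = z%:M.
Proof.
move=> phix phiy; rewrite rmorphD !rmorphM /= phix phiy !mx2M mx2D mx2_scalar.
by rewrite !(mul0r, mulr0, mul1r, mulr1, add0r, addr0).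
Qed.

Lemma superjordan_mx_t (F : nzRingType) (phi : {rmorphism F -> 'M[J]_2}) (y : F) :
  phi y = mx2 0 s 1 0 -> phi (y ^+ 2) = s%:M.
Proof.
move=> phiy; rewrite rmorphXn /= phiy expr2 mx2M mx2_scalar.
by rewrite !(mul0r, mulr0, mul1r, mulr1, add0r, addr0).
Qed.

Lemma superjordan_mx_relation_x (F : nzRingType) (phi : {rmorphism F -> 'M[J]_2}) (x : F) :
  phi x = mx2 0 z 0 0 -> phi (x ^+ 2) = 0.
Proof.
move=> phix; rewrite rmorphXn /= phix expr2 mx2M mx2_0.
by rewrite !(mul0r, mulr0, addr0).
Qed.

(** The commutator of s and z in the upper right corner is exactly z^2, which is
    where the product x z has its only entry. *)
Lemma superjordan_mx_relation_yz (F : nzRingType) (phi : {rmorphism F -> 'M[J]_2})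
    (x y w : F) :
  phi x = mx2 0 z 0 0 -> phi y = mx2 0 s 1 0 -> phi w = z%:M ->
  phi (y * w - w * y - x * w) = 0.
Proof.
move=> phix phiy phiw; rewrite !raddfB /= !rmorphM /= phiw phix phiy mx2_scalar !mx2M.
rewrite !(mul0r, mulr0, mul1r, mulr1, add0r, addr0).
by apply/eqP; rewrite subr_eq0 subr_eq mx2D !addr0 add0r addrC jordan_mul_sz.
Qed.

Definition sjp_letter_mx (i : bool) : 'M[J]_2 :=
  if i then mx2 0 s 1 0 else mx2 0 z 0 0.

Definition sjp_word_mx (m : {fmonom bool}) : 'M[J]_2 := \prod_(i <- m) sjp_letter_mx i.

Lemma sjp_word_mx_mmorphism : mmorphism sjp_word_mx.
Proof.
split; last by rewrite /sjp_word_mx fm1 big_nil.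
by move=> m n; rewrite /sjp_word_mx fmM big_cat.
Qed.
HB.instance Definition _ := monalg.isMultiplicative.Build {fmonom bool} 'M[J]_2
  sjp_word_mx sjp_word_mx_mmorphism.

Definition sjp_scalar_mx (a : k) : 'M[J]_2 := (jordan_const a%:P)%:M.

Lemma sjp_scalar_mx_zmod_morphism : zmod_morphism sjp_scalar_mx.
Proof. by move=> a b; rewrite /sjp_scalar_mx !raddfB. Qed.
HB.instance Definition _ := GRing.isZmodMorphism.Build k 'M[J]_2
  sjp_scalar_mx sjp_scalar_mx_zmod_morphism.
Lemma sjp_scalar_mx_monoid_morphism : monoid_morphism sjp_scalar_mx.
Proof. by split=> [|a b]; rewrite /sjp_scalar_mx ?rmorph1 // !rmorphM. Qed.
HB.instance Definition _ := GRing.isMonoidMorphism.Build k 'M[J]_2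
  sjp_scalar_mx sjp_scalar_mx_monoid_morphism.

(** This makes the linear extension from words to the free algebra multiplicative. *)
Lemma sjp_scalar_mx_central a (M : 'M[J]_2) : GRing.comm (sjp_scalar_mx a) M.
Proof.
rewrite /GRing.comm [M]mx2P /sjp_scalar_mx mx2_scalar !mx2M.
by rewrite !mul0r !mulr0 ?addr0 ?add0r; congr mx2; exact: jordan_scalar_central.
Qed.

Definition free2_mx : free2 -> 'M[J]_2 := mmap sjp_scalar_mx sjp_word_mx.

HB.instance Definition _ := GRing.Additive.copy free2_mx (mmap sjp_scalar_mx sjp_word_mx).

Lemma free2_mx_monoid_morphism : monoid_morphism free2_mx.
Proof.
have [free2M free21] : multiplicative free2_mx.
  by apply: commr_mmap_is_multiplicative => *; exact: sjp_scalar_mx_central.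
by split.
Qed.
HB.instance Definition _ := GRing.isMonoidMorphism.Build free2 'M[J]_2
  free2_mx free2_mx_monoid_morphism.

Lemma free2_mx_letter i : free2_mx << fmu i >> = sjp_letter_mx i.
Proof. by rewrite /free2_mx mmapU /= rmorph1 mul1r /sjp_word_mx fmU big_seq1. Qed.

Lemma free2_mx_x : free2_mx (free_x k) = mx2 0 z 0 0.
Proof. exact: (free2_mx_letter false). Qed.

Lemma free2_mx_y : free2_mx (free_y k) = mx2 0 s 1 0.
Proof. exact: (free2_mx_letter true). Qed.

Lemma free2_mx_z : free2_mx (free_z k) = z%:M.
Proof. exact: superjordan_mx_z free2_mx_x free2_mx_y. Qed.

Lemma free2_mx_ideal f : sjp_ideal f -> free2_mx f = 0.
Proof.
move=> If; apply: (If [set f | free2_mx f = 0]); split.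
  exact: kernel_two_sided.
move=> _ [->|->].
  exact: superjordan_mx_relation_x free2_mx_x.
exact: superjordan_mx_relation_yz free2_mx_x free2_mx_y free2_mx_z.
Qed.

Definition sjp_mx (u : sjp k) : 'M[J]_2 := free2_mx (sjp_repr u).

Lemma sjp_mx_pi f : sjp_mx (sjp_pi f) = free2_mx f.
Proof.
have := free2_mx_ideal (sjp_pi_repr f).
by rewrite (raddfB free2_mx) => /subr0_eq.
Qed.

Lemma sjp_mx_zmod_morphism : zmod_morphism sjp_mx.
Proof.
elim/sjp_ind=> f; elim/sjp_ind=> g.
by rewrite -raddfB !sjp_mx_pi raddfB.
Qed.
HB.instance Definition _ := GRing.isZmodMorphism.Build (sjp k) 'M[J]_2
  sjp_mx sjp_mx_zmod_morphism.

Lemma sjp_mx_monoid_morphism : monoid_morphism sjp_mx.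
Proof.
split; first by rewrite -(rmorph1 (@sjp_pi k)) sjp_mx_pi rmorph1.
elim/sjp_ind=> f; elim/sjp_ind=> g.
by rewrite -rmorphM !sjp_mx_pi rmorphM.
Qed.
HB.instance Definition _ := GRing.isMonoidMorphism.Build (sjp k) 'M[J]_2
  sjp_mx sjp_mx_monoid_morphism.

Lemma sjp_mx_x : sjp_mx sjp_x = mx2 0 z 0 0.
Proof. by rewrite sjp_mx_pi free2_mx_letter. Qed.
Lemma sjp_mx_y : sjp_mx sjp_y = mx2 0 s 1 0.
Proof. by rewrite sjp_mx_pi free2_mx_letter. Qed.
Lemma sjp_mx_scale a u : sjp_mx (a *: u) = sjp_scalar_mx a * sjp_mx u.
Proof. by elim/sjp_ind: u => f; rewrite -linearZ !sjp_mx_pi /free2_mx mmapZ. Qed.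

End Representation.

(** * Even elements, normal elements and their ideals *)
Section NormalForm.
Variables (k : fieldType) (A : algType k) (x y z : A).
Hypothesis zE : z = x * y + y * x.
Hypothesis xx : x * x = 0.
Hypothesis yz : y * z = z * y + x * z.
Local Notation t := (y ^+ 2).
Local Notation xy := (x * y).
Local Notation J := (jordan k).
Local Notation ev := (jordan_eval z (y ^+ 2)).

HB.instance Definition _ := GRing.isMonoidMorphism.Build J A ev
  (jordan_eval_is_monoid_morphism (superjordan_tz zE xx yz)).

Lemma normal_horner w c : jordan_normal y z w -> w * horner_alg z c = horner_alg z c * w.
Proof.
move=> [wz _]; elim/poly_ind: c => [|c a IHc]; first by rewrite rmorph0 mulr0 mul0r.
rewrite rmorphD rmorphM /= horner_algX horner_algC mulrDr mulrA IHc -mulrA wz mulrA.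
by rewrite mulrDl -scalerAr -scalerAl mulr1 mul1r.
Qed.

Lemma normal_eval w f : jordan_normal y z w -> exists g, w * ev f = ev g * w.
Proof.
move=> nw; have [wz wt] := nw; elim/jordan_ind: f => [|f c [g IHf]].
  by exists 0; rewrite raddf0 mulr0 mul0r.
exists (g * (jordan_s k - jordan_z k) + jordan_const c).
rewrite !raddfD /= jordan_eval_const mulrDr normal_horner // mulrDl; congr (_ + _).
rewrite jordan_evalMs mulrA IHf -mulrA wt rmorphM raddfB /= jordan_eval_s jordan_eval_z.
by rewrite mulrA.
Qed.

Lemma eval_normal w g : jordan_normal y z w -> exists f, ev g * w = w * ev f.
Proof.
move=> nw; have [wz wt] := nw; elim/jordan_ind: g => [|g c [f IHg]].
  by exists 0; rewrite raddf0 mulr0 mul0r.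
exists (f * (jordan_s k + jordan_z k) + jordan_const c).
rewrite !raddfD /= jordan_eval_const mulrDr normal_horner // mulrDl; congr (_ + _).
rewrite jordan_evalMs rmorphM raddfD /= jordan_eval_s jordan_eval_z mulrA -IHg.
by rewrite -[ev g * t * w]mulrA -[ev g * w * _]mulrA mulrDr wz wt mulrBl subrK.
Qed.

Lemma normal_leftright w : jordan_normal y z w ->
  [set a * w | a in range ev] = [set w * a | a in range ev].
Proof.
move=> nw; apply/seteqP; split=> _ [_ [f _ <-] <-].
  by have [g ->] := eval_normal f nw; exists (ev g) => //; exists g.
by have [g ->] := normal_eval f nw; exists (ev g) => //; exists g.
Qed.

Definition superjordan_even : set A := [set w | exists a b, w = ev a + ev b * xy].
Definition superjordan_odd : set A := [set w | exists c d, w = ev c * x + ev d * y].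

Lemma superjordan_even1 : superjordan_even 1.
Proof. by exists 1, 0; rewrite rmorph1 raddf0 mul0r addr0. Qed.

Lemma superjordan_even_lin a u v :
  superjordan_even u -> superjordan_even v -> superjordan_even (a *: u + v).
Proof.
move=> [p [q ->]] [p' [q' ->]].
exists (jordan_const a%:P * p + p'), (jordan_const a%:P * q + q').
rewrite !(raddfD ev) /= !jordan_eval_scale.
by rewrite scalerDr !scalerAl mulrDl addrACA.
Qed.

Lemma superjordan_odd_lin a u v :
  superjordan_odd u -> superjordan_odd v -> superjordan_odd (a *: u + v).
Proof.
move=> [p [q ->]] [p' [q' ->]].
exists (jordan_const a%:P * p + p'), (jordan_const a%:P * q + q').
rewrite !(raddfD ev) /= !jordan_eval_scale.
by rewrite scalerDr !scalerAl !mulrDl addrACA.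
Qed.

Lemma superjordan_even_x u : superjordan_even u -> superjordan_odd (u * x).
Proof.
move=> [a [b ->]]; exists (a + b * jordan_z k), 0.
rewrite mulrDl -[_ * xy * x]mulrA (superjordan_xyx zE xx) raddf0 mul0r addr0.
by rewrite rmorphD rmorphM /= jordan_eval_z mulrDl mulrA.
Qed.

Lemma superjordan_even_y u : superjordan_even u -> superjordan_odd (u * y).
Proof.
move=> [a [b ->]]; exists (b * (jordan_s k - jordan_z k)), a.
have [_ xt] := jordan_normal_x zE xx yz.
rewrite mulrDl -!mulrA -expr2 xt rmorphM raddfB /= jordan_eval_s jordan_eval_z.
by rewrite addrC -mulrA.
Qed.

Lemma superjordan_odd_x u : superjordan_odd u -> superjordan_even (u * x).
Proof.
move=> [c [d ->]]; exists (d * jordan_z k), (- d).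
rewrite mulrDl -!mulrA xx mulr0 add0r (superjordan_yx zE) mulrBr.
by rewrite rmorphM /= jordan_eval_z raddfN mulNr.
Qed.

Lemma superjordan_odd_y u : superjordan_odd u -> superjordan_even (u * y).
Proof.
move=> [c [d ->]]; exists (d * jordan_s k), c.
by rewrite mulrDl -!mulrA -expr2 addrC rmorphM /= jordan_eval_s.
Qed.

(** For the products with the even element xy to stay in J w it is enough that xy
    acts on w, on either side, as an element e of J: this is z for w = xy, since
    (xy)^2 = z xy, and 0 for w = z - xy. *)
Lemma normal_ideal w e : jordan_normal y z w -> superjordan_even w ->
  xy * w = ev e * w -> w * xy = ev e * w ->
  two_sided_ideal superjordan_even [set a * w | a in range ev].
Proof.
move=> nw [p [q wE]] xyw wxy; have nxy := jordan_normal_xy zE xx yz.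
split.
- move=> _ [_ [f _ <-] <-]; exists (f * p), (f * q).
  by rewrite wE mulrDr !rmorphM /= mulrA.
- by exists 0; rewrite ?mul0r //; exists 0; rewrite ?raddf0.
- move=> _ _ [_ [f _ <-] <-] [_ [g _ <-] <-]; exists (ev (f - g)); first by exists (f - g).
  by rewrite raddfB mulrBl.
- move=> _ _ [a [b ->]] [_ [f _ <-] <-]; have [g fg] := normal_eval f nxy.
  exists (ev (a * f + b * g * e)); first by eexists.
  rewrite rmorphD !rmorphM /= !mulrDl [ev a * (_ * w)]mulrA; congr (_ + _).
  rewrite -[ev b * xy * _]mulrA [xy * (_ * w)]mulrA fg -[ev g * xy * w]mulrA xyw.
  by rewrite !mulrA.
- move=> _ _ [a [b ->]] [_ [f _ <-] <-].
  have [a' aa'] := normal_eval a nw; have [b' bb'] := normal_eval b nw.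
  exists (ev (f * a' + f * b' * e)); first by eexists.
  rewrite rmorphD !rmorphM /= mulrDr mulrDl -[ev f * w * ev a]mulrA aa' [ev f * (_ * w)]mulrA.
  congr (_ + _); rewrite -[ev f * w * _]mulrA [w * (ev b * _)]mulrA bb'.
  by rewrite -[ev b' * w * _]mulrA wxy !mulrA.
Qed.

(** * Regular elements and zero divisors *)
Section Faithful.
Variable rho : {rmorphism A -> 'M[J]_2}.
Hypothesis rho_scale : forall a u, rho (a *: u) = sjp_scalar_mx a * rho u.
Hypothesis rho_x : rho x = mx2 0 (jordan_z k) 0 0.
Hypothesis rho_y : rho y = mx2 0 (jordan_s k) 1 0.
Hypothesis spanning : forall w,
  exists u v, [/\ superjordan_even u, superjordan_odd v & w = u + v].

Lemma rho_eval f : rho (ev f) = f%:M.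
Proof.
have rho_z : rho z = (jordan_z k)%:M by rewrite zE (superjordan_mx_z rho_x rho_y).
have rho_c c : rho (horner_alg z c) = (jordan_const c)%:M.
  elim/poly_ind: c => [|c a IHc]; first by rewrite !rmorph0.
  rewrite rmorphD rmorphM /= horner_algX horner_algC rmorphD rmorphM /= IHc rho_z.
  by rewrite rho_scale rmorph1 mulr1 !rmorphD !rmorphM.
elim/jordan_ind: f => [|f c IHf]; first by rewrite !rmorph0.
rewrite raddfD /= jordan_evalMs jordan_eval_const rmorphD rmorphM /= IHf rho_c.
by rewrite (superjordan_mx_t rho_y) rmorphD rmorphM.
Qed.

Lemma rho_normal_form a b c d :
  rho (ev a + ev b * xy + (ev c * x + ev d * y))
    = mx2 (a + b * jordan_z k) (c * jordan_z k + d * jordan_s k) d a.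
Proof.
rewrite !rmorphD /= !rmorphM /= !rho_eval rho_x rho_y !mx2_scalar !mx2M !mx2D.
by rewrite !(mul0r, mulr0, mul1r, mulr1, add0r, addr0).
Qed.

Lemma mul_jordan_z_eq0 (a : J) : a * jordan_z k = 0 -> a = 0.
Proof.
by move=> /jordan_mul_eq0 [//|z0]; have := jordan_z_neq0 k; rewrite z0 eqxx.
Qed.

(** The entries determine d and a, then b and c since z is regular in J. *)
Lemma rho_inj w : rho w = 0 -> w = 0.
Proof.
have [_ [_ [[a [b ->]] [c [d ->]] ->]]] := spanning w.
rewrite rho_normal_form mx2_0 => /mx2_inj [E1 E2 d0 a0].
rewrite a0 add0r in E1; rewrite d0 mul0r addr0 in E2.
rewrite a0 d0 (mul_jordan_z_eq0 E1) (mul_jordan_z_eq0 E2) !raddf0.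
by rewrite !mul0r !addr0.
Qed.

Lemma superjordan_xy_neq0 : xy != 0.
Proof.
apply/eqP => xy0; have := rho_normal_form 0 1 0 0.
rewrite xy0 !(raddf0, mulr0, mul0r, add0r, addr0, mul1r) => /esym.
by rewrite mx2_0 => /mx2_inj [z0 _ _ _]; have := jordan_z_neq0 k; rewrite z0 eqxx.
Qed.

Lemma superjordan_yx_neq0 : z - xy != 0.
Proof.
apply/eqP => yx0; have := rho_normal_form (jordan_z k) (- 1) 0 0.
rewrite raddfN /= rmorph1 mulN1r jordan_eval_z yx0 !(raddf0, mul0r, addr0).
rewrite mulN1r subrr => /esym.
by rewrite mx2_0 => /mx2_inj [_ _ _ z0]; have := jordan_z_neq0 k; rewrite z0 eqxx.
Qed.

(** The four entries of either product are entries of g multiplied by one of the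
    two diagonal entries. *)
Lemma superjordan_even_regular a b g : a != 0 -> a + b * jordan_z k != 0 ->
  (ev a + ev b * xy) * g = 0 \/ g * (ev a + ev b * xy) = 0 -> g = 0.
Proof.
move=> /eqP a0 /eqP p0 fg0; apply: rho_inj.
have rho_f : rho (ev a + ev b * xy) = mx2 (a + b * jordan_z k) 0 0 a.
  by have := rho_normal_form a b 0 0; rewrite !(raddf0, mul0r, addr0).
have [p [q [r [s gE]]]] : exists p q r s, rho g = mx2 p q r s.
  by do 4![eexists]; exact: mx2P.
rewrite gE mx2_0; case: fg0 => /(congr1 rho); rewrite rmorphM rho_f gE rmorph0;
  rewrite mx2M mx2_0 !(mul0r, mulr0, add0r, addr0) => /mx2_inj [E1 E2 E3 E4].
  by congr mx2; [move: E1|move: E2|move: E3|move: E4] => /jordan_mul_eq0 [].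
by congr mx2; [move: E1|move: E2|move: E3|move: E4] => /jordan_mul_eq0 [].
Qed.

Let Jxy := [set a * xy | a in range ev].
Let Jyx := [set a * (z - xy) | a in range ev].

Let normal_xy := jordan_normal_xy zE xx yz.
Let normal_yx := jordan_normalB (jordan_normal_z zE xx yz) normal_xy.

Lemma superjordan_even_xy : superjordan_even xy.
Proof. by exists 0, 1; rewrite rmorph1 raddf0 mul1r add0r. Qed.

Lemma superjordan_even_yx : superjordan_even (z - xy).
Proof. by exists (jordan_z k), (- 1); rewrite raddfN /= rmorph1 mulN1r jordan_eval_z. Qed.

Lemma superjordan_regular_or_ideals f : superjordan_even f ->
  (forall g, f * g = 0 \/ g * f = 0 -> g = 0) \/ (Jxy `|` Jyx) f.
Proof.
move=> [a [b ->]].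
have [->|a0] := eqVneq a 0.
  by right; left; exists (ev b); rewrite ?raddf0 ?add0r //; exists b.
have [ab0|ab0] := eqVneq (a + b * jordan_z k) 0.
  right; right; exists (ev (- b)); first by exists (- b).
  move/eqP: ab0; rewrite addr_eq0 => /eqP ->.
  by rewrite !raddfN /= mulNr mulrBr opprB rmorphM /= jordan_eval_z addrC.
by left=> g; exact: superjordan_even_regular.
Qed.

(** A zero divisor of either kind, in the algebra or in its even part, is not
    regular, hence lies in one of the ideals; and each ideal is annihilated on both
    sides by the even generator of the other. *)
Theorem superjordan_zero_divisors f : superjordan_even f ->
  [<-> right_zero_divisor [set: A] f; left_zero_divisor [set: A] f;
       right_zero_divisor superjordan_even f; left_zero_divisor superjordan_even f;
       (Jxy `|` Jyx) f].
Proof.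
move=> Ef.
have to_ideals g : g != 0 -> f * g = 0 \/ g * f = 0 -> (Jxy `|` Jyx) f.
  by case: (superjordan_regular_or_ideals Ef) => // reg g0 /reg g00; rewrite g00 eqxx in g0.
have right_of : (Jxy `|` Jyx) f -> right_zero_divisor superjordan_even f.
  case=> -[a _ <-].
    exists (z - xy); split; [exact: superjordan_even_yx|exact: superjordan_yx_neq0|].
    by rewrite -mulrA (superjordan_xy_yx zE xx yz) mulr0.
  exists xy; split; [exact: superjordan_even_xy|exact: superjordan_xy_neq0|].
  by rewrite -mulrA (superjordan_yx_xy zE xx) mulr0.
have left_of : (Jxy `|` Jyx) f -> left_zero_divisor superjordan_even f.
  rewrite /Jxy /Jyx !normal_leftright //; case=> -[a _ <-].
    exists (z - xy); split; [exact: superjordan_even_yx|exact: superjordan_yx_neq0|].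
    by rewrite mulrA (superjordan_yx_xy zE xx) mul0r.
  exists xy; split; [exact: superjordan_even_xy|exact: superjordan_xy_neq0|].
  by rewrite mulrA (superjordan_xy_yx zE xx yz) mul0r.
tfae.
- move=> [g [_ g0 fg0]].
  by have [h [_ h0 hf0]] := left_of (to_ideals g g0 (or_introl fg0)); exists h.
- by move=> [g [_ g0 gf0]]; exact/right_of/(to_ideals g g0)/or_intror.
- by move=> [g [_ g0 fg0]]; exact/left_of/(to_ideals g g0)/or_introl.
- by move=> [g [_ g0 gf0]]; exact/(to_ideals g g0)/or_intror.
- by move=> /right_of [g [_ g0 fg0]]; exists g.
Qed.

End Faithful.

Theorem superjordan_ideals :
  [/\ [set a * xy | a in range ev] = [set xy * a | a in range ev],
     [set a * (z - xy) | a in range ev] = [set (z - xy) * a | a in range ev],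
     two_sided_ideal superjordan_even [set a * xy | a in range ev]
   & two_sided_ideal superjordan_even [set a * (z - xy) | a in range ev]].
Proof.
have nxy := jordan_normal_xy zE xx yz.
have nyx := jordan_normalB (jordan_normal_z zE xx yz) nxy.
split; try exact: normal_leftright.
  apply: (normal_ideal nxy (e := jordan_z k)); rewrite ?jordan_eval_z;
    rewrite ?(superjordan_xyxy zE xx) //.
  exact: superjordan_even_xy.
apply: (normal_ideal nyx (e := 0)); rewrite ?raddf0 ?mul0r.
- exact: superjordan_even_yx.
- exact: superjordan_xy_yx.
- exact: superjordan_yx_xy.
Qed.
End NormalForm.

(** * The super Jordan plane as a quotient of the free algebra *)
Section Words.
Variables (k : fieldType) (A : algType k) (x y z : A).
Hypothesis zE : z = x * y + y * x.
Hypothesis xx : x * x = 0.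
Hypothesis yz : y * z = z * y + x * z.

(** Multiplying a normal form by a letter on the right gives a normal form of the
    other parity. *)
Lemma superjordan_word (s : seq bool) :
  (if odd (size s) then superjordan_odd x y z else superjordan_even x y z)
    (\prod_(i <- s) if i then y else x).
Proof.
elim/last_ind: s => [|s i IHs]; first by rewrite big_nil; exact: superjordan_even1.
rewrite big_rcons size_rcons /=; case: odd IHs => /= IHs; case: i.
- exact: superjordan_odd_y.
- exact: superjordan_odd_x.
- exact: superjordan_even_y.
- exact: superjordan_even_x.
Qed.

End Words.

Lemma relation_yzE (R : nzRingType) (x y z : R) :
  y * z - z * y - x * z = 0 -> y * z = z * y + x * z.
Proof. by move/eqP; rewrite subr_eq0 subr_eq addrC => /eqP. Qed.

Section SuperJordanPlane.
Variable k : fieldType.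
Local Notation free2 := {malg k[{fmonom bool}]}.
Local Notation x := (@sjp_x k).
Local Notation y := (@sjp_y k).
Local Notation z := (@sjp_z k).

Let zE : z = x * y + y * x. Proof. by []. Qed.
Let xx : x * x = 0. Proof. by rewrite -expr2; exact: sjp_relation_x. Qed.
Let yz : y * z = z * y + x * z.
Proof. exact/relation_yzE/sjp_relation_yz. Qed.

Local Notation even := (superjordan_even x y z).
Local Notation odd := (superjordan_odd x y z).

Lemma sjp_word m :
  (if ssrnat.odd (fdeg m) then odd else even) (sjp_pi (<< m >> : free2)).
Proof. rewrite malg_word; exact (superjordan_word zE xx yz m). Qed.

Lemma sjp_spanning w : exists u v, [/\ even u, odd v & w = u + v].
Proof.
elim/sjp_ind: w => f.
have even0 : even 0 by exists 0, 0; rewrite raddf0 mul0r addr0.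
have odd0 : odd 0 by exists 0, 0; rewrite raddf0 !mul0r addr0.
apply: (malg_lin_ind (phi := @sjp_pi k)
  (S := [set w | exists u v, [/\ even u, odd v & w = u + v]])).
- by exists 0, 0; rewrite addr0.
- move=> a _ _ [u [v [eu ov ->]]] [u' [v' [eu' ov' ->]]].
  exists (a *: u + u'), (a *: v + v'); split.
  + exact (superjordan_even_lin a eu eu').
  + exact (superjordan_odd_lin a ov ov').
  + by rewrite scalerDr addrACA.
move=> m _; have := sjp_word m; case: ssrnat.odd => sm.
  by exists 0, (sjp_pi << m >>); rewrite add0r.
by exists (sjp_pi << m >>), 0; rewrite addr0.
Qed.

(** Describing the even part by the support of a representative makes its closure
    under products immediate, unlike a sum of homogeneous components. *)
Definition free2_even : set free2 := [set f | forall m, f@_m != 0 -> ~~ ssrnat.odd (fdeg m)].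

Lemma free2_even_lin a f g : free2_even f -> free2_even g -> free2_even (a *: f + g).
Proof.
move=> ef eg m; rewrite mcoeffD mcoeffZ; have [->|/ef //] := eqVneq f@_m 0.
by rewrite mulr0 add0r => /eg.
Qed.

Lemma free2_evenM f g : free2_even f -> free2_even g -> free2_even (f * g).
Proof.
move=> ef eg m; rewrite mcoeff_neq0 => /msuppM_le [m1 [m2 [fm1 gm2 ->]]].
by rewrite fdegM oddD (negPf (ef m1 _)) ?mcoeff_neq0 // (negPf (eg m2 _)) ?mcoeff_neq0.
Qed.

Lemma free2_even_letters (i j : bool) : free2_even (<< fmu i >> * << fmu j >>).
Proof.
move=> m; rewrite mcoeff_neq0 => /msuppM_le [m1 [m2 []]].
by rewrite !msuppU1 !inE => /eqP -> /eqP -> ->; rewrite fdegM !fdegU.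
Qed.

Lemma free2_even1 : free2_even 1.
Proof. by move=> m; rewrite mcoeff1; have [->|_] := eqVneq m mone; rewrite ?fdeg1 ?eqxx. Qed.

(** The terms are sorted by half their degree. *)
Lemma free2_even_sjp f : free2_even f -> sjp_even (sjp_pi f).
Proof.
move=> ef; pose n := (\max_(m <- msupp f) fdeg m).+1.
pose F (i : 'I_n) : free2 := \sum_(m <- msupp f | fdeg m == (val i).*2) << f@_m *g m >>.
exists n, (fun i => sjp_pi (F i)); split.
  move=> i; exists (F i) => // m; rewrite /F raddf_sum /=; apply: contraNeq => dm.
  rewrite big1_seq // => m' /andP[/eqP dm' _]; rewrite mcoeffU.
  by have [mm'|//] := eqVneq m' m; rewrite -mm' dm' eqxx in dm.
rewrite -raddf_sum {1}[f]monalgE; congr sjp_pi.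
rewrite /F (exchange_big_dep xpredT) //= big_seq [RHS]big_seq; apply: eq_bigr => m mf.
have even_m : ~~ ssrnat.odd (fdeg m) by apply: ef; rewrite mcoeff_neq0.
have lt_mn : ((fdeg m)./2 < n)%N.
  rewrite ltnS -divn2 (leq_trans (leq_div _ _)) //.
  by apply: (leq_bigmax_seq (F := @fdeg _)).
rewrite (big_pred1 (Ordinal lt_mn)) // => i; rewrite /= -val_eqE /=.
by rewrite -{1}[fdeg m](even_halfK even_m) (inj_eq double_inj) eq_sym.
Qed.

Lemma sjp_even_even w : sjp_even w -> even w.
Proof.
have even0 : even 0 by exists 0, 0; rewrite raddf0 mul0r addr0.
move=> [n [c [hc ->]]]; apply: big_ind => //.
  by move=> u v eu ev; rewrite -[u]scale1r; exact: superjordan_even_lin.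
move=> i _; have [f hf <-] := hc i; apply: malg_lin_ind => //.
  exact: superjordan_even_lin.
by move=> m /hf dm; have := sjp_word m; rewrite dm odd_double.
Qed.

Lemma free2_even_subalgebra : subalgebra (@sjp_pi k @` free2_even).
Proof.
split; first by exists 1; [exact: free2_even1 | exact: (rmorph1 (@sjp_pi k))].
- move=> a _ _ [f ef <-] [g eg <-]; exists (a *: f + g); first exact: free2_even_lin.
  exact: (linearP (@sjp_pi k)).
- move=> _ _ [f ef <-] [g eg <-]; exists (f * g); first exact: free2_evenM.
  exact: (rmorphM (@sjp_pi k)).
Qed.

Let tz : y ^+ 2 * z = z * y ^+ 2 + z * z := superjordan_tz zE xx yz.

Lemma sjp_J_eval : sjp_J = range (jordan_eval z (y ^+ 2)).
Proof. exact (subalgebra_span_jordan tz). Qed.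

(** One inclusion reads off parities of words; for the other, the image of
    [free2_even] is a subalgebra containing z, t and xy, hence J and J xy. *)
Lemma sjp_evenE : sjp_even = even.
Proof.
apply/seteqP; split=> [w|w [a [b ->]]]; first exact: sjp_even_even.
have [_ SL SM] := free2_even_subalgebra.
have Sletters i j : (@sjp_pi k @` free2_even) (sjp_pi << fmu i >> * sjp_pi << fmu j >>).
  exists (<< fmu i >> * << fmu j >>); first exact: free2_even_letters.
  exact: (rmorphM (@sjp_pi k)).
have Sxy : (@sjp_pi k @` free2_even) (x * y) := Sletters false true.
have Syx : (@sjp_pi k @` free2_even) (y * x) := Sletters true false.
have Sz : (@sjp_pi k @` free2_even) z by have := SL 1 _ _ Sxy Syx; rewrite scale1r.
have St : (@sjp_pi k @` free2_even) (y ^+ 2) by rewrite expr2; exact: (Sletters true true).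
have Seval c : (@sjp_pi k @` free2_even) (jordan_eval z (y ^+ 2) c).
  have : sjp_J (jordan_eval z (y ^+ 2) c) by rewrite sjp_J_eval; exists c.
  apply; split; first exact: free2_even_subalgebra.
  by move=> _ [->|->].
have := SL 1 _ _ (Seval a) (SM _ _ (Seval b) Sxy); rewrite scale1r => -[f ef <-].
exact: free2_even_sjp.
Qed.

End SuperJordanPlane.

Theorem proposition4p1 (k : fieldType) (char_neq2 : 2%N \notin [pchar k]) :
  let xy : sjp k := sjp_x * sjp_y in
  [/\ sjp_Jr xy = sjp_lJ xy,
      sjp_Jr (sjp_z - xy) = sjp_lJ (sjp_z - xy),
      two_sided_ideal sjp_even (sjp_Jr xy)
    & two_sided_ideal sjp_even (sjp_Jr (sjp_z - xy))] /\
  (forall f0 : sjp k, sjp_even f0 ->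
    [<-> right_zero_divisor [set: sjp k] f0;
         left_zero_divisor [set: sjp k] f0;
         right_zero_divisor sjp_even f0;
         left_zero_divisor sjp_even f0;
         (sjp_Jr xy `|` sjp_Jr (sjp_z - xy)) f0]).
Proof.
move=> xy; rewrite /sjp_Jr /sjp_lJ sjp_J_eval sjp_evenE.
have zE : sjp_z = sjp_x * sjp_y + sjp_y * sjp_x :> sjp k by [].
have xx : sjp_x * sjp_x = 0 :> sjp k := sjp_relation_x k.
have yz := relation_yzE (sjp_relation_yz k).
split; first exact (superjordan_ideals zE xx yz).
exact (superjordan_zero_divisors zE xx yz (@sjp_mx_scale k) (@sjp_mx_x k) (@sjp_mx_y k)
  (@sjp_spanning k)).
Qed.
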